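(* Let $V,W$ be real Banach spaces, $N\ge1$ and $m\ge1$ integers, $X\colon[0,N]\to V$ a rectifiable path and $Y\colon[0,N]\to L(V,W)$ an $m$-controlled integrand of $X$, with associated paths $Y^0=Y,Y^1,\ldots,Y^m$. Then for every $b\in T^m_1(V)$ and each sign $\pm$, $$I_N^\pm(Y,X)=\int_0^NY_t\,\mathrm{d}X_t-[Y_t\,\pi_1(b)]_{t=0}^N+\sum_{l=2}^m(-1)^l\big[Y_t^{l-1}\pi_l(Z_t^\pm(X,b))\big]_{t=0}^N+R^m(b),$$ where the remainder (depending on the sign) is the Stieltjes integral $$R^m(b)=(-1)^{m+1}\int_0^NY^m_t\,\mathrm{d}\pi_{m+1}(Z_t^\pm(X,b)).$$
   Context: A path is rectifiable if it is continuous and of bounded variation. $V^{\otimes n}$ is (completed) with an admissible norm ($\|v\otimes w\|\le\|v\|\|w\|$, permutation invariant). $L(\cdot,\cdot)$ denotes continuous linear maps. $T^m(V)=\bigoplus_{n=0}^mV^{\otimes n}$, $\pi_n$ is the projection onto $V^{\otimes n}$, $T_1^m(V)=\{v\in T^m(V):\pi_0(v)=1\}$. $[t]$ is the integer part, $[g(t)]_{t=0}^N=g(N)-g(0)$, $\delta X_k=X_{k+1}-X_k$, and $X$ is extended by $X_t=X_N$ for $t\ge N$. A rectifiable path $Y\colon[0,N]\to L(V,W)$ is an $m$-controlled integrand of $X$ if there are rectifiable paths $Y^1,\ldots,Y^m$ such that, with $Y^0=Y$, $Y^l\colon[0,N]\to L(V^{\otimes(l+1)},W)$ for $0\le l\le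 m$ and $\mathrm{d}Y_t^l=Y_t^{l+1}\,\mathrm{d}X_t$ for $0\le l\le m-1$; here $Y^{l+1}_t\,\mathrm{d}X_t$ acts on $w\in V^{\otimes(l+1)}$ by $(Y_t^{l+1}\mathrm{d}X_t)w=Y_t^{l+1}(\mathrm{d}X_t\otimes w)$. Sums: $I_N^-(Y,X)=\sum_{k=0}^{N-1}Y_k\,\delta X_k$, $I_N^+(Y,X)=\sum_{k=0}^{N-1}Y_{k+1}\,\delta X_k$. Sawtooth signatures with initial datum $b$: $\pi_0(Z^\pm_t(X,b))=1$, $\pi_1(Z_t^+(X,b))=X_t-X_{[t]}+\pi_1(b)$, $\pi_1(Z_t^-(X,b))=X_t-X_{[t+1]}+\pi_1(b)$, and for $l\ge2$, $\mathrm{d}\pi_l(Z_t^\pm(X,b))=\mathrm{d}X_t\otimes\pi_{l-1}(Z_t^\pm(X,b))$ with $\pi_l(Z_0^\pm(X,b))=\pi_l(b)$ (for $l\le m$). In the remainder only the differential $\mathrm{d}\pi_{m+1}(Z_t^\pm(X,b))=\mathrm{d}X_t\otimes\pi_m(Z_t^\pm(X,b))$ enters, so no value $\pi_{m+1}(b)$ is needed. *)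

(* Defs.v *)
From HB Require Import structures.
From mathcomp Require Import all_boot all_order all_algebra all_fingroup.
From mathcomp Require Import all_classical all_reals all_analysis.

Set Implicit Arguments.
Unset Strict Implicit.
Unset Printing Implicit Defensive.

Import Order.TTheory GRing.Theory Num.Theory.
Import numFieldNormedType.Exports.

Local Open Scope classical_set_scope.
Local Open Scope ring_scope.

Section continuous_linear_maps.
Variables (R : realType) (V W : normedModType R).

Definition is_clinear : {pred V -> W} :=
  fun f => `[< linear f /\ continuous f >].

Record clinear := CLinear {
  clinear_fun :> V -> W;
  _ : clinear_fun \in is_clinear
}.

HB.instance Definition _ := [isSub for clinear_fun].
HB.instance Definition _ := [Choice of clinear by <:].

Lemma clinearP (f : V -> W) :
  f \in is_clinear <-> linear f /\ continuous f.
Proof. by split=> [/asboolP|?]; last exact/asboolP. Qed.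

Lemma is_clinear_submod : submod_closed is_clinear.
Proof.
split.
  apply/clinearP; split=> [a x y|x]; first by rewrite /= scaler0 addr0.
  exact: cst_continuous.
move=> a f g /clinearP[lf cf] /clinearP[lg cg]; apply/clinearP; split.
  move=> k x y; rewrite -[LHS]/(a *: f (k *: x + y) + g (k *: x + y)).
  rewrite -[RHS]/(k *: (a *: f x + g x) + (a *: f y + g y)).
  rewrite lf lg !scalerDr !scalerA [a * k]mulrC -!addrA; congr (_ + _).
  by rewrite addrCA.
move=> x; apply: (@cvgD _ _ _ _ _ (a \*: f) g); last exact: cg.
by apply: cvgZl_tmp; exact: cf.
Qed.

HB.instance Definition _ :=
  GRing.isSubmodClosed.Build R (V -> W) is_clinear is_clinear_submod.
HB.instance Definition _ := [SubChoice_isSubLmodule of clinear by <:].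

HB.instance Definition _ (f : clinear) :=
  GRing.isLinear.Build R V W *:%R f (proj1 ((clinearP f).1 (valP f))).

Lemma clinear_continuous (f : clinear) : continuous f.
Proof. exact: (proj2 ((clinearP f).1 (valP f))). Qed.

Definition opnorm (f : clinear) : R :=
  sup [set `|f x| | x in [set x : V | `|x| <= 1]].

Lemma opnorm_has_sup (f : clinear) :
  has_sup [set `|f x| | x in [set x : V | `|x| <= 1]].
Proof.
split; first by exists `|f 0|; exists 0; rewrite //= normr0.
have /bounded_funP/(_ 1)[M fM] : bounded_near f (nbhs (0 : V)).
  by apply: continuous_linear_bounded; exact: clinear_continuous.
by exists M => _ [x x1 <-]; exact: fM.
Qed.

Lemma opnorm_le (f : clinear) (M : R) :
  (forall x, `|x| <= 1 -> `|f x| <= M) -> opnorm f <= M.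
Proof.
move=> fM; apply: ge_sup; first exact: (opnorm_has_sup f).1.
by move=> _ [x x1 <-]; exact: fM.
Qed.

Lemma opnorm_ge (f : clinear) x : `|x| <= 1 -> `|f x| <= opnorm f.
Proof.
by move=> x1; apply: ub_le_sup; [exact: (opnorm_has_sup f).2|exists x].
Qed.

Lemma opnormD f g : opnorm (f + g) <= opnorm f + opnorm g.
Proof.
apply: opnorm_le => x x1; rewrite -[X in `|X|]/(f x + g x).
by rewrite (le_trans (ler_normD _ _))// lerD// opnorm_ge.
Qed.

Lemma opnorm_ge0 f : 0 <= opnorm f.
Proof. by rewrite (le_trans (normr_ge0 (f 0)))// opnorm_ge// normr0. Qed.

Lemma opnormZ_le (a : R) f : opnorm (a *: f) <= `|a| * opnorm f.
Proof.
apply: opnorm_le => x x1; rewrite -[X in `|X|]/(a *: f x) normrZ.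
by rewrite ler_wpM2l// opnorm_ge.
Qed.

Lemma opnormZ (a : R) f : opnorm (a *: f) = `|a| * opnorm f.
Proof.
apply/eqP; rewrite eq_le opnormZ_le/=.
have [->|a0] := eqVneq a 0; first by rewrite normr0 mul0r opnorm_ge0.
rewrite -ler_pdivlMl ?normr_gt0// -normfV.
by have := opnormZ_le a^-1 (a *: f); rewrite scalerA mulVf// scale1r.
Qed.

Lemma opnormP (f : clinear) x : `|f x| <= opnorm f * `|x|.
Proof.
have [->|x0] := eqVneq x 0; first by rewrite linear0 !normr0 mulr0.
have nx : 0 < `|x| by rewrite normr_gt0.
rewrite -ler_pdivrMr// mulrC.
have -> : `|x|^-1 * `|f x| = `|f (`|x|^-1 *: x)|.
  by rewrite linearZ normrZ ger0_norm// invr_ge0.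
by apply: opnorm_ge; rewrite normrZ normfV normr_id mulVf ?gt_eqF.
Qed.

Lemma opnorm0_eq0 f : opnorm f = 0 -> f = 0.
Proof.
move=> f0; apply/val_inj/funext => x; apply/eqP.
by rewrite -normr_le0 (le_trans (opnormP f x))// f0 mul0r.
Qed.

HB.instance Definition _ :=
  Lmodule_isNormed.Build R clinear opnormD opnormZ opnorm0_eq0.

End continuous_linear_maps.

Notation "{ 'L' ( V , W ) }" := (clinear V W) (format "{ 'L' ( V ,  W ) }").

Section paths_and_stieltjes_integrals.
Variable R : realType.

(* For a partition a = t_0 < ... < t_k = b, given as in itv_partition by
   s = [t_1; ...; t_k], the point t_i. *)
Definition node (a : R) (s : seq R) (i : nat) : R := nth a (a :: s) i.

Definition path_variation (E : normedModType R) (a : R) (f : R -> E)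
    (s : seq R) : R :=
  \sum_(0 <= i < size s) `|f (node a s i.+1) - f (node a s i)|.

Definition rectifiable (E : normedModType R) (a b : R) (f : R -> E) : Prop :=
  {within `[a, b], continuous f} /\
  exists M, forall s, itv_partition a b s -> path_variation a f s <= M.

Variables (A : Type) (C D : normedModType R) (B : A -> C -> D).

Definition rs_sum (f : R -> A) (g : R -> C) (a : R) (s : seq R)
    (xi : nat -> R) : D :=
  \sum_(0 <= i < size s) B (f (xi i)) (g (node a s i.+1) - g (node a s i)).

(* I is the Riemann-Stieltjes integral over [a, b] (with a <= b) of f against
   g, the values of f acting on the increments of g through B: the limit of
   the Riemann sums as the mesh goes to 0. *)
Definition is_rs_integral (f : R -> A) (g : R -> C) (a b : R) (I : D) : Prop :=
  forall e, 0 < e -> exists2 d, 0 < d &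
    forall s xi, itv_partition a b s ->
      (forall i, (i < size s)%N ->
         node a s i.+1 - node a s i < d /\
         node a s i <= xi i <= node a s i.+1) ->
      `|rs_sum f g a s xi - I| < e.

Definition rs_integrable (f : R -> A) (g : R -> C) (a b : R) : Prop :=
  exists I, is_rs_integral f g a b I.

Definition rs_integral (f : R -> A) (g : R -> C) (a b : R) : D :=
  xget 0 [set I | is_rs_integral f g a b I].

End paths_and_stieltjes_integrals.

Definition clapp (R : realType) (V W : normedModType R) (f : {L(V, W)}) (v : V) :
  W := f v.

Section tensor_powers.
Variables (R : realType) (V : completeNormedModType R).

(* V^{(x)0} = R and V^{(x)1} = V hold definitionally; H k is V^{(x)(k+2)}. *)
Definition tpow_of (H : nat -> completeNormedModType R) (n : nat) :
    completeNormedModType R :=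
  match n with 0 => R^o | 1 => V | k.+2 => H k end.

Definition multilinear_tuple n (U : lmodType R) (f : n.-tuple V -> U) : Prop :=
  forall (i : 'I_n) (v : n.-tuple V) (a : R) (x y : V),
    let upd z := [tuple if j == i then z else tnth v j | j < n] in
    f (upd (a *: x + y)) = a *: f (upd x) + f (upd y).

(* Completed tensor powers of V for a family of admissible norms, described by
   the properties that determine them: tens_universal says that the span of the
   pure tensors is the algebraic tensor power, tens_dense that the complete
   space tpow n is its completion, and tmul is the continuous extension of the
   tensor product. The last two fields are admissibility. *)
Record tensor_powers := TensorPowers {
  tpow_high : nat -> completeNormedModType R;
  tpow := tpow_of tpow_high;
  tens : forall n, n.-tuple V -> tpow n;
  tens0 : tens [tuple] = (1 : R);
  tens1 : forall v : V, tens [tuple v] = v;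
  tens_multilinear : forall n, multilinear_tuple (@tens n);
  tens_universal : forall n (U : lmodType R) (f : n.-tuple V -> U),
    multilinear_tuple f ->
    exists g : {linear tpow n -> U}, forall v, g (tens v) = f v;
  tens_dense : forall n,
    dense [set \sum_(p <- s) p.1 *: tens p.2 | s in [set: seq (R * n.-tuple V)]];
  tmul : forall p q, tpow p -> tpow q -> tpow (p + q);
  tmul_linear_l : forall p q (y : tpow q), linear (fun x : tpow p => tmul x y);
  tmul_linear_r : forall p q (x : tpow p), linear (fun y : tpow q => tmul x y);
  tmul_tens : forall p q (v : p.-tuple V) (w : q.-tuple V),
    tmul (tens v) (tens w) = tens (cat_tuple v w);
  norm_tmul : forall p q (x : tpow p) (y : tpow q),
    `|tmul x y| <= `|x| * `|y|;
  norm_perm : forall n (sigma : 'S_n) (s : seq (R * n.-tuple V)),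
    `|\sum_(p <- s) p.1 *: tens [tuple tnth p.2 (sigma i) | i < n]|
    = `|\sum_(p <- s) p.1 *: tens p.2|
}.

Variable T : tensor_powers.

Definition tcons n (v : V) (w : tpow T n) : tpow T n.+1 := @tmul T 1 n v w.

(* T^m(V); outside of its range 0, ..., m the projection tproj is 0. *)
Definition truncated_tensors (m : nat) := forall i : 'I_m.+1, tpow T i.

Definition tproj m (l : nat) (b : truncated_tensors m) : tpow T l :=
  match @idP (l < m.+1)%N with
  | ReflectT lm => b (Ordinal lm)
  | ReflectF _ => 0
  end.

Definition unital_tensors (m : nat) : set (truncated_tensors m) :=
  [set b | tproj 0 b = (1 : R)].

Section contraction.
Variables (W : normedModType R) (n : nat).

Lemma contract_subproof (A : {L(tpow T n.+1, W)}) (v : V) :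
  (fun w : tpow T n => A (tcons v w)) \in @is_clinear R (tpow T n) W.
Proof.
have lin : linear (fun w : tpow T n => A (tcons v w)).
  by move=> a x y; rewrite /tcons (@tmul_linear_r T 1 n v a x y) linearP.
apply/clinearP; split=> //.
pose f : {linear tpow T n -> W} :=
  HB.pack (fun w : tpow T n => A (tcons v w)) (GRing.isLinear.Build _ _ _ _ _ lin).
apply: (@bounded_linear_continuous _ _ _ f); apply/bounded_funP => r.
exists (opnorm A * (`|v| * r)) => x xr.
rewrite (le_trans (opnormP A _))// ler_wpM2l ?opnorm_ge0//.
by rewrite (le_trans (@norm_tmul T 1 n v x))// ler_wpM2l.
Qed.

Definition contract (A : {L(tpow T n.+1, W)}) (v : V) : {L(tpow T n, W)} :=
  CLinear (contract_subproof A v).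

End contraction.

(* Y 0 = Y, Y 1, ..., Y m are an m-controlled integrand of X on [0, N] together
   with its associated paths; Y l is irrelevant for l > m. *)
Definition controlled_integrand (W : normedModType R) (N m : nat) (X : R -> V)
    (Y : forall l : nat, R -> {L(tpow T l.+1, W)}) : Prop :=
  (forall l, (l <= m)%N -> rectifiable 0 N%:R (Y l)) /\
  (forall l s t, (l < m)%N -> 0 <= s -> s <= t -> t <= N%:R ->
     is_rs_integral (@contract W l.+1) (Y l.+1) X s t (Y l t - Y l s)).

Variant pm := Plus | Minus.

Definition stopped (N : nat) (X : R -> V) (t : R) : V := X (Num.min t N%:R).

Definition sawtooth1 (N m : nat) (X : R -> V) (b : truncated_tensors m)
    (eps : pm) (t : R) : V :=
  let tau := match eps with Plus => Num.floor t | Minus => Num.floor (t + 1) end in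
  stopped N X t - stopped N X tau%:~R + (tproj 1 b : V).

(* pi_l (Z^eps_t(X, b)). For l = m + 1 the initial value is tproj m.+1 b = 0;
   only the increments of that component are used. *)
Fixpoint sawtooth (N m : nat) (X : R -> V) (b : truncated_tensors m)
    (eps : pm) (l : nat) : R -> tpow T l :=
  match l return R -> tpow T l with
  | 0 => fun=> (1 : R)
  | l1.+1 =>
    match l1 return (R -> tpow T l1) -> R -> tpow T l1.+1 with
    | 0 => fun _ t => sawtooth1 N X b eps t
    | l2.+1 => fun Z t =>
        tproj l2.+2 b + rs_integral (fun z v => tcons v z) Z X 0 t
    end (sawtooth N X b eps l1)
  end.

End tensor_powers.

Section sums.
Variable R : realType.

Definition riemann_sum (V W : normedModType R) (N : nat) (eps : pm)
    (Y : R -> {L(V, W)}) (X : R -> V) : W :=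
  \sum_(0 <= k < N)
    Y (match eps with Plus => k.+1 | Minus => k end)%:R (X k.+1%:R - X k%:R).

Definition increment (E : normedModType R) (N : nat) (g : R -> E) : E :=
  g N%:R - g 0.

End sums.

(* Main.v *)
(* Call a quantity E(x, z, y) attached to tagged intervals x <= z <= y
   negligible if |E| <= e (w y - w x) on short intervals, for one nondecreasing w
   and every e > 0: such quantities vanish when summed, so that a function with
   negligible increments is constant.  Stieltjes integrals of f against g are
   encoded by primitives h, for which h y - h x - f z (g y - g x) is negligible.
   Then d(Y^j Z_{j+1}) = Y^j dZ_{j+1} + Y^{j+1} dX (x) Z_{j+1}
   = Y^j dZ_{j+1} + Y^{j+1} dZ_{j+2} is checked on increments, and the formula is
   the resulting alternating telescoping sum.  For j = 0 the jumps of Z_1 at the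
   integers are avoided by working on each [k, k + 1] with left tags, where Z_1 is
   X - X_k + b_1 or X - X_{k+1} + b_1: the boundary terms then produce the
   k-th term of the Riemann sum. *)
Require Import Defs.
From HB Require Import structures.
From mathcomp Require Import all_boot all_order all_algebra all_fingroup.
From mathcomp Require Import all_classical all_reals all_analysis.
From mathcomp Require Import ring lra.

Set Implicit Arguments.
Unset Strict Implicit.
Unset Printing Implicit Defensive.

Import Order.TTheory GRing.Theory Num.Theory.
Import numFieldNormedType.Exports.

Local Open Scope classical_set_scope.
Local Open Scope ring_scope.

(** * Partitions of an interval and sums over their nodes *)

Section partitions.
Variable R : realType.
Implicit Types (a b d : R) (s : seq R) (w : R -> R).

Definition nondecr_on a b w : Prop :=
  forall x y, a <= x -> x <= y -> y <= b -> w x <= w y.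

Lemma node_cons a x s i : (i <= size s)%N -> node a (x :: s) i.+1 = node x s i.
Proof. by move=> si; rewrite /node /=; apply: set_nth_default. Qed.

Lemma node_size a b s : itv_partition a b s -> node a s (size s) = b.
Proof. by move=> ps; rewrite /node (itv_partition_nth_size a ps). Qed.

Lemma node_bounds a b s i : itv_partition a b s -> (i < size s)%N ->
  [/\ a <= node a s i, node a s i < node a s i.+1 & node a s i.+1 <= b].
Proof.
elim: s a i => // x s ih a [|i] ps /= si.
  rewrite node_cons//; have xb := itv_partition_le (itv_partition_cons ps).
  by case: ps => /andP[ax _] _.
rewrite ltnS in si; have [xi ii ib] := ih x i (itv_partition_cons ps) si.
rewrite !node_cons ?(ltnW si)//; split=> //; apply: le_trans xi.
by case: ps => /andP[/ltW].
Qed.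

Lemma fine_partition a b d : a <= b -> 0 < d ->
  exists2 s, itv_partition a b s &
    forall i, (i < size s)%N -> node a s i.+1 - node a s i < d.
Proof.
move=> ab d0; have d20 : 0 < d / 2 by lra.
(* Steps of length [d / 2] are split off at [a] one at a time; [n] bounds their number and drives
   the induction. *)
have [n] : exists n, b - a < n%:R * (d / 2).
  exists (Num.bound ((b - a) / (d / 2))); rewrite -ltr_pdivrMr//.
  by apply: archi_boundP; rewrite divr_ge0// ?subr_ge0// ltW.
elim: n a ab => [|n ih] a ab; first by rewrite mul0r; lra.
move=> abn; have [abd|abd] := ltP (b - a) d.
  have [->|aneb] := eqVneq a b; first by exists [::] => //; split.
  exists [:: b] => [|[|//] _]; first by apply: itv_partition1; lra.
  by rewrite /node.
have [||s ps sd] := ih (a + d / 2); first by lra.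
  by move: abn; rewrite -natr1 mulrDl mul1r; lra.
exists (a + d / 2 :: s).
  by case: ps => ps pl; split=> //=; rewrite ps andbT; lra.
case=> [_|i si]; first by rewrite node_cons// /node /=; lra.
by rewrite ltnS in si; rewrite !node_cons ?(ltnW si)//; exact: sd.
Qed.

Lemma ler_norm_node_sum (D : normedModType R) a b s (F : nat -> D) w :
  itv_partition a b s ->
  (forall i, (i < size s)%N -> `|F i| <= w (node a s i.+1) - w (node a s i)) ->
  `|\sum_(0 <= i < size s) F i| <= w b - w a.
Proof.
move=> ps Fw; rewrite (le_trans (ler_norm_sum _ _ _))//.
have -> : w b - w a =
    \sum_(0 <= i < size s) (w (node a s i.+1) - w (node a s i)).
  by rewrite (telescope_sumr (w \o node a s)) //= (node_size ps).
by rewrite big_nat [leRHS]big_nat; apply: ler_sum => i /andP[_]; exact: Fw.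
Qed.

Lemma node_telescope (D : zmodType) a b s (g : R -> D) :
  itv_partition a b s ->
  \sum_(0 <= i < size s) (g (node a s i.+1) - g (node a s i)) = g b - g a.
Proof.
by move=> ps; rewrite (telescope_sumr (g \o node a s)) //= (node_size ps).
Qed.

(** Increments of [w] add up, so a bound valid on short intervals extends to all intervals through a
    fine partition and the triangle inequality. *)
Lemma local_variation_bound (D : normedModType R) a b d (h : R -> D) w :
  0 < d ->
  (forall x y, a <= x -> x < y -> y <= b -> y - x < d ->
     `|h y - h x| <= w y - w x) ->
  forall x y, a <= x -> x <= y -> y <= b -> `|h y - h x| <= w y - w x.
Proof.
move=> d0 hw x y ax xy yb; have [s ps sd] := fine_partition xy d0.
rewrite -(node_telescope h ps); apply: ler_norm_node_sum => // i si.
have [xi ii iy] := node_bounds ps si.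
by apply: hw => //; [exact: le_trans xi|exact: le_trans yb|exact: sd].
Qed.

End partitions.

(** * Bounded variation and uniform continuity of rectifiable paths *)

Section variation.
Variable R : realType.
Implicit Types (a b : R) (w : R -> R).

(* A function has bounded variation iff its increments are dominated by those
   of a real function, which is then automatically nondecreasing. *)
Definition var_bound (E : normedModType R) a b (f : R -> E) w : Prop :=
  forall x y, a <= x -> x <= y -> y <= b -> `|f y - f x| <= w y - w x.

Definition bounded_var (E : normedModType R) a b (f : R -> E) : Prop :=
  exists w, var_bound a b f w.

Definition unif_cont_on (E : normedModType R) a b (f : R -> E) : Prop :=
  forall e, 0 < e -> exists2 d, 0 < d & forall x y,
    a <= x <= b -> a <= y <= b -> `|x - y| < d -> `|f x - f y| <= e.

Lemma var_bound_nondecr (E : normedModType R) a b (f : R -> E) w :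
  var_bound a b f w -> nondecr_on a b w.
Proof.
by move=> fw x y ax xy yb; rewrite -subr_ge0 (le_trans _ (fw x y ax xy yb)).
Qed.

Lemma bounded_var_bounded (E : normedModType R) a b (f : R -> E) :
  bounded_var a b f ->
  exists2 M, 0 < M & forall x, a <= x <= b -> `|f x| <= M.
Proof.
move=> [w fw]; exists (`|f a| + `|w b - w a| + 1) => [|x /andP[ax xb]].
  by rewrite ltr_wpDl// addr_ge0.
have -> : f x = f a + (f x - f a) by rewrite addrC subrK.
rewrite (le_trans (ler_normD _ _))// -addrA lerD2l.
have := fw a x (lexx a) ax xb; have := var_bound_nondecr fw ax xb (lexx b).
by have := ler_norm (w b - w a); lra.
Qed.

(** The dominating function sends [t] to the variation of [f] on [[a, t]]: appending [y] to a
    partition of [[a, x]] increases the sum by exactly [|f y - f x|]. *)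
Lemma bounded_var_rectifiable (E : normedModType R) a b (f : R -> E) :
  rectifiable a b f -> bounded_var a b f.
Proof.
move=> [_ [M fM]].
pose S t := [set path_variation a f s | s in [set s | itv_partition a t s]].
have add x y s : x < y -> itv_partition a x s ->
    itv_partition a y (rcons s y) /\
    path_variation a f (rcons s y) = path_variation a f s + `|f y - f x|.
  move=> xy ps; split.
    case: ps => ps /eqP sx; split; last by rewrite last_rcons.
    by rewrite rcons_path ps sx.
  have no i : (i <= size s)%N -> node a (rcons s y) i = node a s i.
    by rewrite /node -rcons_cons nth_rcons /= ltnS => ->.
  rewrite /path_variation size_rcons big_nat_recr//=; congr (_ + _).
    by apply: eq_big_nat => i /andP[_ si]; rewrite !no// ltnW.
  rewrite (no _ (leqnn _)) (node_size ps); congr `|f _ - _|.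
  by rewrite /node -rcons_cons nth_rcons /= ltnn eqxx.
(* A partition of [[a, t]] with [t < b] is completed by the point [b], which only increases its
   sum. *)
have Sub t : t <= b -> ubound (S t) M.
  move=> tb _ [s ps <-]; have [tb'|tb'] := ltP t b; last first.
    by apply: fM; have <- : t = b by lra.
  have [pb vb] := add t b s tb' ps.
  by apply: le_trans (fM _ pb); rewrite vb lerDl.
have S0 t : a <= t -> S t !=set0.
  by move=> /fine_partition/(_ ltr01)[s ps _]; exists (path_variation a f s), s.
exists (fun t => sup (S t)) => x y ax; rewrite le_eqVlt => /orP[/eqP<- xb|xy yb].
  by rewrite !subrr normr0.
rewrite lerBrDr addrC -lerBrDr; apply: ge_sup.
  by apply: S0.
move=> _ [s ps <-]; rewrite lerBrDr; have [py vy] := add x y s xy ps.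
rewrite -vy; apply: ub_le_sup; last by exists (rcons s y).
by exists M; exact: Sub.
Qed.

(** Heine's theorem. Compactness is used in near-covering form along the filter of radii tending to
    0 from the right: [P d x] holds near each point for all small [d], hence for one [d] at all
    points. *)
Lemma rectifiable_unif_cont (E : normedModType R) a b (f : R -> E) :
  rectifiable a b f -> unif_cont_on a b f.
Proof.
move=> [cf _] e e0.
have /compact_near_coveringP/near_covering_withinP := @segment_compact _ a b.
pose P (d : R) (x : R) := forall y, a <= y <= b -> `|x - y| < d -> `|f x - f y| <= e.
move=> /(_ R 0^'+ P _)[].
  move=> x xab; have e20 : 0 < e / 2 by lra.
  move/subspace_continuousP : cf => /(_ x xab)/cvgr_dist_le/(_ _ e20).
  rewrite /within /= => /nbhs_ballP[r /= r0 fr].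
  have r20 : 0 < r / 2 by lra.
  exists (ball x (r / 2), [set d : R | d < r / 2]) => /=.
    split; first exact: nbhsx_ballx.
    by apply: nbhs_right_lt.
  move=> [x' d] /= [xx' dr]; rewrite /P => x'ab y yab x'y.
  have x'r : `|x - x'| < r / 2 by exact: xx'.
  have h z : a <= z <= b -> `|x - z| < r -> `|f x - f z| <= e / 2.
    by move=> zab xz; apply: fr; rewrite /= ?in_itv.
  have -> : f x' - f y = (f x - f y) - (f x - f x').
    by rewrite opprB [RHS]addrC addrA subrK.
  rewrite (le_trans (ler_normB _ _))// (splitr e) lerD//; apply: h => //; last by lra.
    by rewrite (le_lt_trans (ler_distD x' _ _))//; lra.
move=> d /= d0 dP; exists (d / 2); first by lra.
move=> x y xab yab xyd; apply: (dP (d / 2)) => //=; last by lra.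
by rewrite sub0r normrN gtr0_norm; lra.
Qed.

End variation.

(** * Calculus of negligible tagged increments *)

Section negligible_increments.
Variable R : realType.
Implicit Types (a b : R).

Definition negligible (D : normedModType R) a b (E : R -> R -> R -> D) : Prop :=
  exists2 w, nondecr_on a b w & forall e, 0 < e -> exists2 d, 0 < d &
    forall x z y, a <= x -> x <= z -> z <= y -> x < y -> y <= b -> y - x < d ->
      `|E x z y| <= e * (w y - w x).

Lemma negligible_le (D D' : normedModType R) a b
    (E : R -> R -> R -> D) (E' : R -> R -> R -> D') M : 0 < M ->
  negligible a b E ->
  (forall x z y, a <= x -> x <= z -> z <= y -> x < y -> y <= b ->
     `|E' x z y| <= M * `|E x z y|) ->
  negligible a b E'.
Proof.
move=> M0 [w ndw Ew] E'E; exists w => // e e0.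
have [d d0 Ed] := Ew (e / M) (divr_gt0 e0 M0); exists d => // x z y ax xz zy xy yb yx.
rewrite (le_trans (E'E _ _ _ ax xz zy xy yb))//.
by rewrite -ler_pdivlMl// mulrA [M^-1 * e]mulrC; exact: Ed.
Qed.

Lemma negligible_eq (D : normedModType R) a b (E E' : R -> R -> R -> D) :
  negligible a b E ->
  (forall x z y, a <= x -> x <= z -> z <= y -> x < y -> y <= b ->
     E' x z y = E x z y) ->
  negligible a b E'.
Proof.
move=> nE E'E; apply: (negligible_le ltr01 nE) => x z y ax xz zy xy yb.
by rewrite E'E// mul1r.
Qed.

Lemma negligibleD (D : normedModType R) a b (E E' : R -> R -> R -> D) :
  negligible a b E -> negligible a b E' ->
  negligible a b (fun x z y => E x z y + E' x z y).
Proof.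
move=> [w ndw Ew] [w' ndw' Ew'].
exists (w \+ w') => [x y ax xy yb /=|e e0]; first by rewrite lerD ?ndw ?ndw'.
have [d d0 Ed] := Ew e e0; have [d' d'0 Ed'] := Ew' e e0.
exists (Num.min d d') => [|x z y ax xz zy xy yb]; first by rewrite lt_min d0.
rewrite lt_min => /andP[yd yd']; rewrite (le_trans (ler_normD _ _))//=.
by rewrite opprD addrACA mulrDr lerD ?Ed ?Ed'.
Qed.

Lemma negligibleN (D : normedModType R) a b (E : R -> R -> R -> D) :
  negligible a b E -> negligible a b (fun x z y => - E x z y).
Proof.
by move=> nE; apply: (negligible_le ltr01 nE) => *; rewrite normrN mul1r.
Qed.

Lemma negligibleB (D : normedModType R) a b (E E' : R -> R -> R -> D) :
  negligible a b E -> negligible a b E' ->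
  negligible a b (fun x z y => E x z y - E' x z y).
Proof. by move=> nE nE'; apply: negligibleD => //; exact: negligibleN. Qed.

(** Left tags satisfy [x < y], so on [[k, k + 1]] they stay away from the right end, where the first
    sawtooth component may jump. *)
Lemma negligible_left (D : normedModType R) a b (E : R -> R -> R -> D) :
  negligible a b E -> negligible a b (fun x _ y => E x x y).
Proof.
move=> [w ndw Ew]; exists w => // e /Ew[d d0 Ed]; exists d => // x z y *.
by apply: Ed => //; exact: ltW.
Qed.

Lemma negligible_sub (D : normedModType R) a b a' b' (E : R -> R -> R -> D) :
  a <= a' -> b' <= b -> negligible a b E -> negligible a' b' E.
Proof.
move=> aa bb [w ndw Ew]; exists w.
  by move=> x y ax xy yb; apply: ndw => //; [exact: le_trans ax|exact: le_trans bb].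
move=> e /Ew[d d0 Ed]; exists d => // x z y ax xz zy xy yb.
by apply: Ed => //; [exact: le_trans ax|exact: le_trans bb].
Qed.

Lemma negligible_const (D : normedModType R) a b (h : R -> D) : a <= b ->
  negligible a b (fun x _ y => h y - h x) -> h b = h a.
Proof.
move=> ab [w ndw hw]; apply/eqP; rewrite -subr_eq0 -normr_le0.
apply/ler_addgt0Pr => e e0; rewrite add0r.
(* The added 1 keeps the divisor positive even when [w] is constant. *)
have c0 : 0 < w b - w a + 1 by have := ndw a b (lexx a) ab (lexx b); lra.
have [d d0 hd] := hw (e / (w b - w a + 1)) (divr_gt0 e0 c0).
have := @local_variation_bound _ _ a b d h
  (fun x => e / (w b - w a + 1) * w x) d0.
move=> /(_ _ a b (lexx a) ab (lexx b)) H.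
apply: (le_trans (H _)).
  move=> x y ax xy yb yx; rewrite -mulrBr.
  by apply: (hd x x y) => //; exact: ltW.
rewrite -mulrBr -mulrA -[leRHS]mulr1 ler_pM2l//.
by rewrite ler_pdivrMl// mulr1; lra.
Qed.

(** Second-order terms vanish: uniform continuity makes one factor at most [e], and bounded
    variation dominates the other by an increment of [w]. The subinterval [[p, q]] allows for both
    [[x, z]] and [[z, y]]. *)
Lemma negligible_prod (C E F : normedModType R) a b (f : R -> C) (g : R -> E)
    (G : R -> R -> R -> F) :
  bounded_var a b f -> bounded_var a b g ->
  unif_cont_on a b f \/ unif_cont_on a b g ->
  (forall x z y, a <= x -> x <= z -> z <= y -> x < y -> y <= b ->
     exists p q, [/\ x <= p, p <= q, q <= y &
       `|G x z y| <= `|f q - f p| * `|g q - g p|]) ->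
  negligible a b G.
Proof.
move=> [wf fw] [wg gw] fg Gfg.
have ndf := var_bound_nondecr fw; have ndg := var_bound_nondecr gw.
case: fg => [uc|uc]; [exists wg => //|exists wf => //];
    move=> e /uc[d d0 ud]; exists d => // x z y ax xz zy xy yb yx;
    have [p [q [xp pq qy Gpq]]] := Gfg x z y ax xz zy xy yb;
    apply: (le_trans Gpq).
- apply: ler_pM => //.
    by apply: ud; [apply/andP; split; lra..|rewrite ger0_norm; lra].
  apply: le_trans (gw p q _ _ _) _; [lra..|].
  by have := ndg x p ax xp; have := ndg q y _ qy yb; lra.
- rewrite mulrC; apply: ler_pM => //.
    by apply: ud; [apply/andP; split; lra..|rewrite ger0_norm; lra].
  apply: le_trans (fw p q _ _ _) _; [lra..|].
  by have := ndf x p ax xp; have := ndf q y _ qy yb; lra.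
Qed.

End negligible_increments.

(** * Pairings, primitives and Riemann-Stieltjes integrals *)

Section primitives.
Variable R : realType.
Implicit Types (a b : R).

(** Biadditive maps of norm at most 1: the common form of evaluation, contraction and tensor
    multiplication. Additivity is phrased with differences because only increments are paired. *)
Definition short_pairing (A C D : normedModType R) (B : A -> C -> D) : Prop :=
  [/\ forall x x' y, B (x - x') y = B x y - B x' y,
      forall x y y', B x (y - y') = B x y - B x y' &
      forall x y, `|B x y| <= `|x| * `|y|].

Section pairing_theory.
Variables (A C D : normedModType R) (B : A -> C -> D).
Hypothesis B_short : short_pairing B.

Lemma pairingBl x x' y : B (x - x') y = B x y - B x' y.
Proof. by case: B_short. Qed.

Lemma pairingBr x y y' : B x (y - y') = B x y - B x y'.
Proof. by case: B_short. Qed.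

Lemma pairing_norm x y : `|B x y| <= `|x| * `|y|.
Proof. by case: B_short. Qed.

Lemma pairing0r x : B x 0 = 0.
Proof. by rewrite -(subrr 0) pairingBr subrr. Qed.

Lemma pairingDr x y y' : B x (y + y') = B x y + B x y'.
Proof.
by rewrite -[y' in LHS]opprK pairingBr -[- y']sub0r pairingBr pairing0r sub0r opprK.
Qed.

Lemma pairing_sumr x n (F : nat -> C) :
  B x (\sum_(0 <= i < n) F i) = \sum_(0 <= i < n) B x (F i).
Proof. exact: (big_morph _ (pairingDr x) (pairing0r x)). Qed.

End pairing_theory.

Lemma short_pairing_flip (A C D : normedModType R) (B : A -> C -> D) :
  short_pairing B -> short_pairing (fun y x => B x y).
Proof.
by move=> [Bl Br Bn]; split=> // x y; rewrite mulrC.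
Qed.

Definition is_primitive (A : Type) (C D : normedModType R) (B : A -> C -> D) a b
    (f : R -> A) (g : R -> C) (h : R -> D) : Prop :=
  negligible a b (fun x z y => h y - h x - B (f z) (g y - g x)).

(** Whatever the tags, the defects over the pieces of a fine partition add up to a small multiple of
    [w y - w x]. *)
Lemma primitive_rs_integral (A : Type) (C D : normedModType R) (B : A -> C -> D)
    a b f g h : is_primitive B a b f g h ->
  forall x y, a <= x -> x <= y -> y <= b ->
    is_rs_integral B f g x y (h y - h x).
Proof.
move=> [w ndw hw] x y ax xy yb e e0.
have c0 : 0 < w y - w x + 1 by have := ndw x y ax xy yb; lra.
have [d d0 hd] := hw (e / (w y - w x + 1)) (divr_gt0 e0 c0).
exists d => // s xi ps sd; rewrite -normrN opprB /rs_sum.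
rewrite -(node_telescope h ps) -sumrB.
apply: (@le_lt_trans _ _ (e / (w y - w x + 1) * w y - e / (w y - w x + 1) * w x)).
  apply: (ler_norm_node_sum (w := fun t => e / (w y - w x + 1) * w t) ps) => i si.
  rewrite -mulrBr.
  have [xi1 ii iy] := node_bounds ps si; have [di /andP[ix xi2]] := sd i si.
  by apply: hd => //; [exact: le_trans xi1|exact: le_trans yb].
rewrite -mulrBr -mulrA -[ltRHS]mulr1 ltr_pM2l//.
by rewrite ltr_pdivrMl// mulr1; lra.
Qed.

Lemma rs_integral_unique (A : Type) (C D : normedModType R) (B : A -> C -> D)
    a b f g I J : a <= b ->
  is_rs_integral B f g a b I -> is_rs_integral B f g a b J -> I = J.
Proof.
move=> ab hI hJ; apply/eqP; rewrite -subr_eq0 -normr_le0.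
apply/ler_addgt0Pr => e e0; rewrite add0r; have e20 : 0 < e / 2 by lra.
have [d d0 Id] := hI _ e20; have [d' d'0 Jd] := hJ _ e20.
have dd0 : 0 < Num.min d d' by rewrite lt_min d0.
have [s ps sd] := fine_partition ab dd0.
have {}sd : forall i, (i < size s)%N -> node a s i.+1 - node a s i < d /\
    node a s i.+1 - node a s i < d'.
  by move=> i /sd; rewrite lt_min => /andP[].
have tag i : (i < size s)%N -> node a s i <= node a s i <= node a s i.+1.
  by move=> si; have [_ /ltW-> _] := node_bounds ps si; rewrite lexx.
have {}Id := Id s (node a s) ps (fun i si => conj (sd i si).1 (tag i si)).
have {}Jd := Jd s (node a s) ps (fun i si => conj (sd i si).2 (tag i si)).
set S := rs_sum _ _ _ _ _ _ in Id Jd.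
have -> : I - J = (S - J) - (S - I) by rewrite opprB [RHS]addrC addrA subrK.
by rewrite (le_trans (ler_normB _ _))// (splitr e) lerD// ltW.
Qed.

Lemma rs_integralE (A : Type) (C D : normedModType R) (B : A -> C -> D)
    a b f g I : a <= b ->
  is_rs_integral B f g a b I -> rs_integral B f g a b = I.
Proof.
move=> ab hI; apply: xget_unique => // J hJ; exact: rs_integral_unique hJ hI.
Qed.

(** Converse for a uniformly continuous integrand: on a short interval each value [f (node x s i)]
    in a Riemann sum may be replaced by [f z] at a cost of [e] times the variation of [g]. The slack
    [c] absorbs the distance from the Riemann sum to the integral. *)
Lemma indefinite_integral_primitive (A C D : normedModType R) (B : A -> C -> D)
    a b f g h :
  short_pairing B -> unif_cont_on a b f -> bounded_var a b g ->
  (forall x y, a <= x -> x <= y -> y <= b ->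
     is_rs_integral B f g x y (h y - h x)) ->
  is_primitive B a b f g h.
Proof.
move=> sB fc [w gw] hI; exists w => [|e e0]; first exact: var_bound_nondecr gw.
have [d d0 fd] := fc e e0; exists d => // x z y ax xz zy xy yb yx.
apply/ler_addgt0Pr => c c0.
have [d' d'0 Id] := hI x y ax (ltW xy) yb c c0.
have [s ps sd] := fine_partition (ltW xy) d'0.
have tag i : (i < size s)%N -> node x s i <= node x s i <= node x s i.+1.
  by move=> si; have [_ /ltW-> _] := node_bounds ps si; rewrite lexx.
have {}Id := Id s (node x s) ps (fun i si => conj (sd i si) (tag i si)).
set S := rs_sum _ _ _ _ _ _ in Id.
have -> : h y - h x - B (f z) (g y - g x) =
    (S - B (f z) (g y - g x)) - (S - (h y - h x)).
  by rewrite opprB [RHS]addrC addrA subrK.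
rewrite (le_trans (ler_normB _ _))// lerD//; last exact: ltW.
rewrite -(node_telescope g ps) (pairing_sumr sB) -sumrB mulrBr.
apply: (ler_norm_node_sum (w := fun t => e * w t) ps) => i si.
have [xi ii iy] := node_bounds ps si.
rewrite -(pairingBl sB) (le_trans (pairing_norm sB _ _))// -mulrBr ler_pM//.
  apply: fd; [apply/andP; split; lra..|].
  by rewrite ltr_norml; apply/andP; split; lra.
by apply: gw; lra.
Qed.

(** On short intervals the defect is at most the increment of [w], and the main term at most [M]
    times that of [wg]. This carries bounded variation from one sawtooth level to the next. *)
Lemma primitive_variation (A C D : normedModType R) (B : A -> C -> D) a b f g h :
  short_pairing B -> bounded_var a b f -> bounded_var a b g ->
  is_primitive B a b f g h -> bounded_var a b h.
Proof.
move=> sB /bounded_var_bounded[M M0 fM] [wg gw] [w ndw hw].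
have [d d0 hd] := hw 1 ltr01; exists (fun t => w t + M * wg t).
apply: (@local_variation_bound _ _ a b d) => // x y ax xy yb yx.
have -> : h y - h x = (h y - h x - B (f x) (g y - g x)) + B (f x) (g y - g x).
  by rewrite subrK.
rewrite (le_trans (ler_normD _ _))// opprD addrACA -mulrBr lerD//.
  by have := hd x x y; rewrite mul1r; apply=> //; exact: ltW.
rewrite (le_trans (pairing_norm sB _ _))// ler_pM//.
  by apply: fM; apply/andP; split; lra.
by apply: gw => //; exact: ltW.
Qed.

(** Leibniz rule. With both factors frozen at the tag [z], the error is exactly the product of
    increments over [[z, y]] minus that over [[x, z]]. *)
Lemma product_increment (A C D : normedModType R) (B : A -> C -> D) a b f g :
  short_pairing B -> bounded_var a b f -> bounded_var a b g ->
  unif_cont_on a b f \/ unif_cont_on a b g ->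
  negligible a b (fun x z y => B (f y) (g y) - B (f x) (g x)
    - (B (f z) (g y - g x) + B (f y - f x) (g z))).
Proof.
move=> sB fv gv fg.
have n1 : negligible a b (fun x z y => B (f y - f z) (g y - g z)).
  apply: (negligible_prod fv gv fg) => x z y ax xz zy xy yb.
  by exists z, y; split=> //; exact: pairing_norm.
have n2 : negligible a b (fun x z y => B (f z - f x) (g z - g x)).
  apply: (negligible_prod fv gv fg) => x z y ax xz zy xy yb.
  by exists x, z; split=> //; exact: pairing_norm.
apply: negligible_eq (negligibleB n1 n2) _ => x z y _ _ _ _ _.
rewrite !(pairingBl sB) !(pairingBr sB).
rewrite !opprD !opprK !addrA addrK.
by rewrite [RHS](ACl (1*6*3*4*2*5)%AC).
Qed.

End primitives.

(** * Existence of primitives in a complete space *)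

Section existence_of_primitives.
Variable R : realType.
Implicit Types (a b : R).

Lemma subrACA (V : zmodType) (x y z t : V) : x - y - (z - t) = x - z - (y - t).
Proof. by rewrite opprD addrACA -opprD. Qed.

Lemma ler_addVnat (x y c : R) : (forall k, x <= y + c / k.+1%:R) -> x <= y.
Proof.
move=> H; apply/ler_addgt0Pr => e e0.
have [c0|c0] := leP c 0.
  apply: le_trans (H 0%N) _; rewrite divr1; lra.
pose k := Num.bound (c / e).
have := archi_boundP (ltW (divr_gt0 c0 e0)); rewrite -/k => ck.
apply: le_trans (H k) _; rewrite lerD2l ler_pdivrMr ?ltr0n//.
move: ck; rewrite ltr_pdivrMr// => /ltW/le_trans; apply.
by rewrite mulrC ler_wpM2l ?(ltW e0)// ler_nat.
Qed.

Lemma cauchy_rate_limit (D : completeNormedModType R) (u : nat -> D) (c : R) :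
  (forall n k, `|u n - u k| <= c / n.+1%:R + c / k.+1%:R) ->
  exists l, forall n, `|u n - l| <= c / n.+1%:R.
Proof.
move=> uc.
have c0 : 0 <= c by have := uc 0%N 0%N; rewrite subrr normr0 !divr1; lra.
have : cvg (u @ \oo).
  apply/cauchy_cvgP/cauchy_exP => e e0.
  have e20 : 0 < e / 2 by lra.
  pose n := Num.bound (c / (e / 2)).
  have := archi_boundP (divr_ge0 c0 (ltW e20)); rewrite -/n => cn.
  have small k : (n <= k)%N -> c / k.+1%:R < e / 2.
    move=> nk; rewrite ltr_pdivrMr ?ltr0n//.
    move: cn; rewrite ltr_pdivrMr// => /lt_le_trans; apply.
    by rewrite mulrC ler_wpM2l ?(ltW e20)// ler_nat; apply: leq_trans nk _.
  exists (u n); exists n => // k /= nk; rewrite -ball_normE /=.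
  by rewrite (le_lt_trans (uc n k))// (splitr e) ltrD// small.
move=> /cvg_ex[l ul]; exists l => n; apply/ler_addgt0Pr => e e0.
have e20 : 0 < e / 2 by lra.
have /cvgrPdist_le/(_ _ e20)[k0 _ kl] := ul.
apply: (@ler_addVnat _ _ c) => k1; pose k := maxn k0 k1.
have {}kl : `|u k - l| <= e / 2 by rewrite distrC; apply: kl; rewrite /= leq_maxl.
have -> : u n - l = (u n - u k) + (u k - l) by rewrite addrA subrK.
rewrite (le_trans (ler_normD _ _))// (le_trans (lerD (uc n k) kl))//.
have aux (p q r : R) : q <= r -> p + q + e / 2 <= p + e + r by lra.
by apply: aux; rewrite ler_wpM2l// lef_pV2 ?posrE ?ltr0n// ler_nat ltnS leq_maxr.
Qed.

(** The function [h] integrates the step function with value [f (u i)] between the nodes [u i] and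
    [u i.+1]. Mesh and interval length are both below [r / 2], so [z] is within [r] of [u i]
    whenever the piece meets [[x, y]]. *)
Lemma approximate_primitive (A C D : normedModType R) (B : A -> C -> D) a b f g w e :
  a <= b -> short_pairing B -> unif_cont_on a b f -> var_bound a b g w -> 0 < e ->
  exists h d, [/\ h a = 0, 0 < d & forall x z y, a <= x -> x <= z -> z <= y ->
    x < y -> y <= b -> y - x < d ->
    `|h y - h x - B (f z) (g y - g x)| <= e * w y - e * w x].
Proof.
move=> ab sB fc gw e0; have [r r0 fr] := fc e e0.
have r20 : 0 < r / 2 by lra.
have [s ps sd] := fine_partition ab r20; set u := node a s in sd.
have ua i : (i <= size s)%N -> a <= u i.
  case: i => [_|i si]; first by rewrite /u /node.
  by have [ai /ltW ii _] := node_bounds ps si; exact: le_trans ii.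
have usize : u (size s) = b by exact: node_size.
exists (fun t => \sum_(0 <= i < size s)
  B (f (u i)) (g (Num.min t (u i.+1)) - g (Num.min t (u i)))), (r / 2).
split=> //.
  rewrite big_nat big1// => i /andP[_ si].
  by rewrite !min_l ?ua ?(ltnW si)// subrr (pairing0r sB).
(* The nodes clamped to [[x, y]] split both [g y - g x] and [w y - w x]; pieces outside [[x, y]]
   collapse to zero. *)
move=> x z y ax xz zy xy yb yx; pose cl i := Num.max x (Num.min y (u i)).
have clE i : g (Num.min y (u i)) - g (Num.min x (u i)) = g (cl i) - g x.
  rewrite /cl; have [ux|xu] := leP (u i) x.
    rewrite (min_r (le_trans ux (ltW xy))) max_l//; first by rewrite !subrr.
  have [uy|yu] := leP (u i) y; first by rewrite max_r// ltW.
  by rewrite max_r// ltW.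
have cl0 : cl 0%N = x.
  by rewrite /cl /u /node /= min_r ?max_l// (le_trans ax)// ltW.
have clsize : cl (size s) = y by rewrite /cl usize min_l// max_r// ltW.
have gE : g y - g x = \sum_(0 <= i < size s) (g (cl i.+1) - g (cl i)).
  by rewrite (telescope_sumr (g \o cl)) //= cl0 clsize.
rewrite gE (pairing_sumr sB) -!sumrB.
have -> : e * w y - e * w x =
    \sum_(0 <= i < size s) (e * w (cl i.+1) - e * w (cl i)).
  by rewrite (telescope_sumr (fun i => e * w (cl i))) //= cl0 clsize.
rewrite (le_trans (ler_norm_sum _ _ _))// big_nat [leRHS]big_nat.
apply: ler_sum => i /andP[_ si].
rewrite -(pairingBr sB).
have -> : g (Num.min y (u i.+1)) - g (Num.min y (u i)) -
    (g (Num.min x (u i.+1)) - g (Num.min x (u i))) = g (cl i.+1) - g (cl i).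
  by rewrite subrACA !clE opprB addrA subrK.
rewrite -(pairingBl sB) (le_trans (pairing_norm sB _ _))// -mulrBr.
have [ai ii ib] := node_bounds ps si.
have := sd i si; rewrite -/u in ai ii ib * => sdi.
have [uix|xui] := leP (u i.+1) x.
  rewrite /cl !(min_r (y := u _)) ?(max_l (x := x)); [|lra..].
  by rewrite !subrr normr0 !mulr0.
have [yui|uiy] := leP y (u i).
  rewrite /cl !(min_l (x := y)) ?(max_r (x := x)); [|lra..].
  by rewrite !subrr normr0 !mulr0.
rewrite ler_pM//.
  apply: fr; [apply/andP; split; lra..|].
  by rewrite ltr_norml; apply/andP; split; lra.
apply: gw.
- by rewrite /cl le_max ax.
- by rewrite /cl le_max2 ?lexx// le_min2 ?lexx// ltW.
- by rewrite /cl ge_max (le_trans (ltW xy))//= ge_min yb.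
Qed.

(** Approximate primitives [h_ n] with error [1 / (n + 1)] form a Cauchy sequence, since the
    increments of [h_ n - h_ k] are dominated by those of [W n k]; the primitive is their pointwise
    limit. *)
Lemma exists_primitive_cont (A C : normedModType R) (D : completeNormedModType R)
    (B : A -> C -> D) a b f g :
  a <= b -> short_pairing B -> unif_cont_on a b f -> bounded_var a b g ->
  exists h, is_primitive B a b f g h.
Proof.
move=> ab sB fc [w gw]; have ndw := var_bound_nondecr gw.
have e0 n : 0 < n.+1%:R^-1 :> R by rewrite invr_gt0 ltr0n.
have /choice[h_ /choice[d_ hd]] := fun n => approximate_primitive ab sB fc gw (e0 n).
pose W n k t := n.+1%:R^-1 * w t + k.+1%:R^-1 * w t.
have diff n k x y : a <= x -> x <= y -> y <= b ->
    `|h_ n y - h_ k y - (h_ n x - h_ k x)| <= W n k y - W n k x.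
  have [_ d0 hn] := hd n; have [_ d'0 hk] := hd k.
  apply: (@local_variation_bound _ _ a b (Num.min (d_ n) (d_ k))
    (fun t => h_ n t - h_ k t)).
    by rewrite lt_min d0.
  move=> {}x {}y ax xy yb; rewrite lt_min => /andP[yxn yxk].
  have -> : h_ n y - h_ k y - (h_ n x - h_ k x) =
      (h_ n y - h_ n x - B (f x) (g y - g x)) -
      (h_ k y - h_ k x - B (f x) (g y - g x)).
    by rewrite subrACA [in RHS]opprB addrA subrK.
  rewrite (le_trans (ler_normB _ _))// /W opprD addrACA lerD//.
    by apply: hn => //; exact: ltW.
  by apply: hk => //; exact: ltW.
(* The guard makes the limit total in [t], with default 0 outside [[a, b]], so that choice yields a
   function. *)
have lim t : exists l, a <= t <= b ->
    forall n, `|h_ n t - l| <= (w b - w a) / n.+1%:R.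
  have [/andP[at_ tb]|_] := boolP (a <= t <= b); last by exists 0.
  have [n k|l hl] := @cauchy_rate_limit D (fun n => h_ n t) (w b - w a);
    last by exists l.
  have := diff n k a t (lexx a) at_ tb.
  have [-> _ _] := hd n; have [-> _ _] := hd k.
  rewrite !subr0 => /le_trans; apply; rewrite /W opprD addrACA -!mulrBr.
  have wt : w t - w a <= w b - w a by rewrite lerD2r ndw.
  by rewrite lerD// mulrC ler_wpM2r// ltW.
have [h hlim] := choice lim.
exists h, w => // e ee0.
pose n := Num.bound (2 / e).
have ne : n.+1%:R^-1 <= e / 2.
  rewrite -[e / 2]invrK lef_pV2 ?posrE ?ltr0n ?invr_gt0//; last by lra.
  rewrite invf_div; apply: le_trans (ltW (archi_boundP _)) _.
    by rewrite divr_ge0// ltW.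
  by rewrite ler_nat.
have [_ d0 hn] := hd n; exists (d_ n) => // x z y ax xz zy xy yb yx.
have -> : h y - h x - B (f z) (g y - g x) =
    (h_ n y - h_ n x - B (f z) (g y - g x)) - (h_ n y - h y - (h_ n x - h x)).
  by rewrite [X in _ = _ - X]subrACA [RHS]addrAC subKr.
have wxy := ndw x y ax (ltW xy) yb.
have half : n.+1%:R^-1 * (w y - w x) <= e / 2 * (w y - w x).
  by rewrite ler_wpM2r// subr_ge0.
rewrite (le_trans (ler_normB _ _))// (splitr e) mulrDl lerD//.
  by apply: le_trans (hn x z y ax xz zy xy yb yx) _; rewrite -mulrBr.
apply: le_trans half.
(* Here [k] tends to infinity; the constant collects the [1 / (k + 1)] terms coming from [diff] and
   from the convergence rates at [y] and [x]. *)
apply: (@ler_addVnat _ _ (w y - w x + (w b - w a) + (w b - w a))) => k.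
have hx := hlim x _ k; have hy := hlim y _ k.
have -> : h_ n y - h y - (h_ n x - h x) = (h_ n y - h_ k y - (h_ n x - h_ k x))
    + ((h_ k y - h y) - (h_ k x - h x)).
  by rewrite [LHS]subrACA [X in _ = X + _]subrACA [X in _ = _ + X]subrACA addrA subrK.
rewrite (le_trans (ler_normD _ _))//.
apply: le_trans (lerD (diff n k x y ax (ltW xy) yb) (ler_normB _ _)) _.
apply: le_trans (lerD (lexx _) (lerD (hy _) (hx _))) _.
- by apply/andP; split; lra.
- by apply/andP; split; lra.
by rewrite /W le_eqVlt; apply/orP; left; apply/eqP; ring.
Qed.

(** If only [g] is uniformly continuous, integration by parts gives the primitive as [B f g] minus a
    primitive of [g] against [f]. This covers the first sawtooth component, which jumps, integrated
    against [X]. *)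
Lemma exists_primitive (A C : normedModType R) (D : completeNormedModType R)
    (B : A -> C -> D) a b f g :
  a <= b -> short_pairing B -> bounded_var a b f -> bounded_var a b g ->
  unif_cont_on a b f \/ unif_cont_on a b g ->
  exists h, is_primitive B a b f g h.
Proof.
move=> ab sB fv gv fg; case: (fg) => [fc|gc]; first exact: exists_primitive_cont.
have [k kP] := exists_primitive_cont ab (short_pairing_flip sB) gc fv.
exists (fun t => B (f t) (g t) - k t).
apply: negligible_eq (negligibleB (product_increment sB fv gv fg) kP) _.
move=> x z y _ _ _ _ _ /=.
have alg (p q u v r c : D) : p - u - (q - v) - r = p - q - (r + c) - (u - v - c).
  by rewrite subrACA [in RHS]opprB (opprD r c) (addrA (p - q)) subrKA [RHS]addrAC.
exact: alg.
Qed.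

End existence_of_primitives.

(** * Restriction to subintervals *)

Section restriction.
Variables (R : realType) (E : normedModType R) (a b a' b' : R).
Hypotheses (aa' : a <= a') (b'b : b' <= b).

Lemma bounded_var_restrict (f : R -> E) : bounded_var a b f -> bounded_var a' b' f.
Proof.
move=> [w fw]; exists w => x y ax xy yb.
by apply: fw => //; [exact: le_trans ax|exact: le_trans b'b].
Qed.

Lemma unif_cont_restrict (f : R -> E) : unif_cont_on a b f -> unif_cont_on a' b' f.
Proof.
move=> fc e /fc[d d0 fd]; exists d => // x y /andP[ax xb] /andP[ay yb].
by apply: fd; rewrite ?(le_trans aa' ax) ?(le_trans aa' ay) ?(le_trans xb b'b) ?(le_trans yb b'b).
Qed.

End restriction.

(** * Tensor pairings and integration by parts for controlled paths *)

Section tensor_pairings.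
Variable R : realType.

Lemma linear_subr (U U' : lmodType R) (f : U -> U') : linear f ->
  forall x y, f (x - y) = f x - f y.
Proof. by move=> lf x y; rewrite addrC -scaleN1r lf scaleN1r addrC. Qed.

Lemma clapp_short (V W : normedModType R) : short_pairing (@clapp R V W).
Proof.
split=> [f g v|f v w|f v] //; first by rewrite /clapp linearB.
exact: opnormP.
Qed.

Variables (V : completeNormedModType R) (T : tensor_powers V).

Lemma tcons_short n : short_pairing (fun (z : tpow T n) (v : V) => tcons v z).
Proof.
split=> [z z' v|z v v'|z v].
- by apply: (linear_subr (@tmul_linear_r _ _ T 1 n v)).
- by apply: (linear_subr (fun a x y => @tmul_linear_l _ _ T 1 n z a x y)).
- by rewrite mulrC; exact: (@norm_tmul _ _ T 1 n v z).
Qed.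

Lemma contract_short (W : normedModType R) n :
  short_pairing (@Defs.contract R V T W n).
Proof.
split=> [A A' v|A v v'|A v].
- by apply/val_inj/funext => w.
- apply/val_inj/funext => w.
  rewrite -[LHS]/(A (tcons (v - v') w)) -[RHS]/(A (tcons v w) - A (tcons v' w)).
  by rewrite (pairingBr (tcons_short n)) linearB.
- apply: opnorm_le => w w1; rewrite -[X in `|X|]/(A (tcons v w)).
  rewrite (le_trans (opnormP _ _))// ler_wpM2l ?opnorm_ge0//.
  rewrite (le_trans (pairing_norm (tcons_short n) _ _))//.
  by rewrite mulrC ler_piMr.
Qed.

(** This is [d(A P) = A dP + (dA) P] with [(dA) P = A' (dX (x) P) = A' dQ]. The relation for [Q] is
    asked with left tags only, so [P] may differ from a sawtooth component at the right end. *)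
Lemma controlled_integration_by_parts (W : normedModType R) n (a b : R)
    (A : R -> {L(tpow T n.+1, W)}) (A' : R -> {L(tpow T n.+2, W)}) (X : R -> V)
    (P : R -> tpow T n.+1) (Q : R -> tpow T n.+2) (H G : R -> W) :
  a <= b ->
  bounded_var a b A -> unif_cont_on a b A -> bounded_var a b A' ->
  bounded_var a b P ->
  is_primitive (@Defs.contract R V T W n.+1) a b A' X A ->
  is_primitive (@clapp R _ _) a b A P H ->
  is_primitive (@clapp R _ _) a b A' Q G ->
  negligible a b (fun x _ y => Q y - Q x - tcons (X y - X x) (P x)) ->
  A b (P b) - A a (P a) = (H b - H a) + (G b - G a).
Proof.
move=> ab Av Ac A'v Pv AP HP GP QP.
have E1 := negligible_left
  (product_increment (@clapp_short _ _) Av Pv (or_introl Ac)).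
have E2 := negligible_left HP; have E3 := negligible_left GP.
have [M M0 PM] := bounded_var_bounded Pv.
have [M' M'0 A'M] := bounded_var_bounded A'v.
have E4 : negligible a b (fun x _ y =>
    clapp (A y - A x - Defs.contract (A' x) (X y - X x)) (P x)).
  apply: (negligible_le M0 (negligible_left AP)) => x z y ax xz zy xy yb.
  rewrite (le_trans (pairing_norm (@clapp_short _ _) _ _))// mulrC.
  by rewrite ler_wpM2r// PM//; apply/andP; split; lra.
have E5 : negligible a b (fun x _ y =>
    clapp (A' x) (Q y - Q x - tcons (X y - X x) (P x))).
  apply: (negligible_le M'0 QP) => x z y ax xz zy xy yb.
  rewrite (le_trans (pairing_norm (@clapp_short _ _) _ _))//.
  by rewrite ler_wpM2r// A'M//; apply/andP; split; lra.
(* The errors of the Leibniz rule, of [dA = A' dX], of the two primitives and of [dQ] combine to the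
   increment of [A P - H - G]. *)
have N := negligibleB (negligibleB (negligibleB (negligibleD E1 E4) E2) E3) E5.
have /(negligible_const ab)/eqP : negligible a b (fun x _ y =>
    (A y (P y) - H y - G y) - (A x (P x) - H x - G x)).
  apply: negligible_eq N _ => x z y _ _ _ _ _; cbv beta.
  rewrite (pairingBl (@clapp_short _ _) (A y - A x)).
  rewrite (pairingBr (@clapp_short _ _) (A' x) (Q y - Q x) (tcons _ _)).
  rewrite -[clapp (Defs.contract _ _) _]/(clapp (A' x) (tcons (X y - X x) (P x))).
  have alg (ay ax p q c hy hx gy gx r : W) :
    ay - hy - gy - (ax - hx - gx) =
    ay - ax - (p + q) + (q - c) - (hy - hx - p) - (gy - gx - r) - (r - c).
    rewrite [LHS]subrACA [X in X - _]subrACA.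
    move: (ay - ax) (hy - hx) (gy - gx) => s t u.
    rewrite (opprD p) (addrA s) subrKA [in RHS](addrAC s) (opprB t) subrKA.
    by rewrite [in RHS](addrAC s) (opprB u) (addrAC _ (r - u)) (opprB r) subrKA subrKA.
  exact: alg.
rewrite -subr_eq0 subrACA [X in X - _]subrACA => /eqP.
by rewrite -addrA -opprD => /subr0_eq.
Qed.

End tensor_pairings.

(** * Sawtooth signatures and their integrals *)

Section sawtooth_theory.
Variables (R : realType) (V : completeNormedModType R) (T : tensor_powers V).
Variables (N m : nat) (X : R -> V) (b : truncated_tensors T m) (eps : pm).
Hypothesis X_rect : rectifiable 0 N%:R X.
Let N0 : 0 <= N%:R :> R := ler0n R N.
Let Xv : bounded_var 0 N%:R X := bounded_var_rectifiable X_rect.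
Let Xc : unif_cont_on 0 N%:R X := rectifiable_unif_cont X_rect.
Let Z := sawtooth N X b eps.

(** The integer at which [X] is subtracted in the first component on [[k, k + 1)]. *)
Let knot (k : nat) : R := match eps with Plus => k%:R | Minus => k.+1%:R end.

Lemma sawtooth1_knot k t : (k < N)%N -> k%:R <= t < k.+1%:R ->
  Z 1 t = X t - X (knot k) + tproj 1 b.
Proof.
move=> kN /andP[kt tk].
have kN' : k.+1%:R <= N%:R :> R by rewrite ler_nat.
have tkz : (k : int)%:~R <= t < ((k : int) + 1)%:~R.
  by rewrite intrD -pmulrn kt natr1.
rewrite /Z /sawtooth /sawtooth1 /stopped (min_l (ltW (lt_le_trans tk kN'))).
congr (_ - X _ + _); rewrite /knot; case: eps.
  by rewrite (floor_def tkz) min_l// ltW// (lt_le_trans _ kN')// ltr_nat.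
rewrite (@floor_def _ _ k.+1) ?min_l//.
by rewrite -addn1 PoszD !intrD -!natrD !addn1; lra.
Qed.

(** Up to a constant, [Z 1] is [X] minus [X] composed with the nondecreasing map [s], the integer
    part capped at [N]. *)
Lemma sawtooth1_bounded_var : bounded_var 0 N%:R (Z 1).
Proof.
have [w Xw] := Xv.
pose s (t : R) : R := Num.min
  (match eps with Plus => Num.floor t | Minus => Num.floor (t + 1) end)%:~R N%:R.
exists (fun t => w t + w (s t)) => x y x0 xy yN.
have sxy : s x <= s y.
  rewrite /s le_min2 ?lexx// ler_int.
  by case: eps; apply: le_floor => //; rewrite lerD2r.
have sx0 : 0 <= s x.
  rewrite /s le_min N0 andbT; have: (0 : int)%:~R <= x by [].
  case: eps => x0'; rewrite ler0z floor_ge0//; lra.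
have syN : s y <= N%:R by rewrite /s ge_min lexx orbT.
have -> : Z 1 y - Z 1 x = (X y - X x) - (X (s y) - X (s x)).
  rewrite /Z /sawtooth /sawtooth1 /stopped -/(s x) -/(s y).
  rewrite (min_l yN) (min_l (le_trans xy yN)).
  by rewrite opprD addrACA subrr addr0 subrACA.
by rewrite (le_trans (ler_normB _ _))// opprD addrACA lerD ?Xw.
Qed.

(** Induction on the level: bounded variation of a component gives a primitive against [X], which by
    uniqueness of the integral is the next component up to a constant, and is again of bounded
    variation. *)
Lemma sawtooth_primitive_bounded_var l :
  bounded_var 0 N%:R (Z l.+1) /\
  is_primitive (fun z v => tcons v z) 0 N%:R (Z l.+1) X (Z l.+2).
Proof.
have step k : bounded_var 0 N%:R (Z k.+1) ->
    is_primitive (fun z v => tcons v z) 0 N%:R (Z k.+1) X (Z k.+2).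
  move=> Zv.
  have [h hP] := exists_primitive N0 (@tcons_short _ _ T k.+1) Zv Xv (or_intror Xc).
  have ZE t : 0 <= t -> t <= N%:R -> Z k.+2 t = tproj k.+2 b + (h t - h 0).
    move=> t0 tN; rewrite -[LHS]/(tproj k.+2 b +
      rs_integral (fun z v => tcons v z) (Z k.+1) X 0 t).
    congr (_ + _); apply: rs_integralE => //.
    exact: (primitive_rs_integral hP).
  apply: negligible_eq hP _ => x z y x0 xz zy xy yN.
  rewrite !ZE//; [|lra..].
  by rewrite opprD addrACA subrr add0r opprB addrA subrK.
elim: l => [|l [Zv ZP]].
  by split; [|apply: step]; exact: sawtooth1_bounded_var.
have Zv' := primitive_variation (@tcons_short _ _ T l.+1) Zv Xv ZP.
by split=> //; exact: step.
Qed.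

Variables (W : completeNormedModType R) (Y : forall l : nat, R -> {L(tpow T l.+1, W)}).
Hypothesis Y_ctrl : controlled_integrand N m X Y.

Let Yrect l : (l <= m)%N -> rectifiable 0 N%:R (Y l).
Proof. by case: Y_ctrl => + _; exact. Qed.

Let YP l : (l < m)%N ->
  is_primitive (@Defs.contract R V T W l.+1) 0 N%:R (Y l.+1) X (Y l).
Proof.
move=> lm; apply: indefinite_integral_primitive => //.
- exact: contract_short.
- by apply: rectifiable_unif_cont; exact: Yrect.
- by move=> x y x0 xy yN; exact: (Y_ctrl.2 l x y lm x0 xy yN).
Qed.

Lemma sawtooth_integral_exists j : (j <= m)%N ->
  exists G, is_primitive (@clapp R _ W) 0 N%:R (Y j) (Z j.+1) G.
Proof.
move=> jm; apply: exists_primitive => //.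
- exact: clapp_short.
- by apply: bounded_var_rectifiable; exact: Yrect.
- by have [] := sawtooth_primitive_bounded_var j.
- by left; apply: rectifiable_unif_cont; exact: Yrect.
Qed.

Lemma sawtooth_integral_step j G G' : (j.+1 < m)%N ->
  is_primitive (@clapp R _ W) 0 N%:R (Y j.+1) (Z j.+2) G ->
  is_primitive (@clapp R _ W) 0 N%:R (Y j.+2) (Z j.+3) G' ->
  increment N (fun t => Y j.+1 t (Z j.+2 t)) = increment N G + increment N G'.
Proof.
move=> jm GP G'P; apply: (controlled_integration_by_parts
    (A := Y j.+1) (A' := Y j.+2) (X := X) (P := Z j.+2) (Q := Z j.+3) N0) => //.
- by apply: bounded_var_rectifiable; apply: Yrect; exact: ltnW.
- by apply: rectifiable_unif_cont; apply: Yrect; exact: ltnW.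
- by apply: bounded_var_rectifiable; exact: Yrect.
- by have [] := sawtooth_primitive_bounded_var j.+1.
- exact: YP.
- exact: (negligible_left (proj2 (sawtooth_primitive_bounded_var j.+1))).
Qed.

(** The lowest level, where integration by parts on each [[k, k + 1]] turns boundary terms into the
    terms of the Riemann sum. *)
Lemma riemann_sum_sawtooth H G : (0 < m)%N ->
  is_primitive (@clapp R V W) 0 N%:R (Y 0%N) X H ->
  is_primitive (@clapp R _ W) 0 N%:R (Y 1%N) (Z 2) G ->
  riemann_sum N eps (Y 0%N) X =
    increment N H - increment N (fun t => Y 0%N t (tproj 1 b)) + increment N G.
Proof.
move=> m0 HP GP.
pose F t := H t - Y 0%N t (tproj 1 b) + G t.
have -> : increment N H - increment N (fun t => Y 0%N t (tproj 1 b)) + increment N G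
    = \sum_(0 <= k < N) (F k.+1%:R - F k%:R).
  rewrite (telescope_sumr (fun k => F k%:R))// /increment /F.
  by rewrite subrACA [in RHS]opprD [RHS]addrACA.
apply: eq_big_nat => k /andP[_ kN].
have k0 : 0 <= k%:R :> R by [].
have kN' : k.+1%:R <= N%:R :> R by rewrite ler_nat.
have kk : k%:R <= k.+1%:R :> R by rewrite ler_nat.
(* [P] equals [Z 1] on [[k, k + 1)] but has no jump at [k + 1], and its increments are those of
   [X]. *)
pose P t : tpow T 1 := X t - X (knot k) + tproj 1 b.
have PB x y : P y - P x = X y - X x.
  by rewrite /P opprD addrACA subrr addr0 opprB addrA subrK.
have Pv : bounded_var k%:R k.+1%:R P.
  have [w Xw] := bounded_var_restrict k0 kN' Xv.
  by exists w => x y kx xy yk; rewrite PB Xw.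
have HP' : is_primitive (@clapp R _ W) k%:R k.+1%:R (Y 0%N) P H.
  apply: negligible_eq (negligible_sub k0 kN' HP) _ => x z y _ _ _ _ _.
  by rewrite PB.
have QP : negligible k%:R k.+1%:R
    (fun x _ y => Z 2 y - Z 2 x - tcons (X y - X x) (P x)).
  have ZP := negligible_left (proj2 (sawtooth_primitive_bounded_var 0)).
  apply: negligible_eq (negligible_sub k0 kN' ZP) _ => x z y kx _ _ xy yk.
  by rewrite (sawtooth1_knot kN)// kx (lt_le_trans xy).
have Y0 := Yrect (ltnW m0); have Y1 := Yrect m0.
have := controlled_integration_by_parts kk
  (bounded_var_restrict k0 kN' (bounded_var_rectifiable Y0))
  (unif_cont_restrict k0 kN' (rectifiable_unif_cont Y0))
  (bounded_var_restrict k0 kN' (bounded_var_rectifiable Y1)) Pv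
  (negligible_sub k0 kN' (YP m0)) HP' (negligible_sub k0 kN' GP) QP.
have -> : F k.+1%:R - F k%:R = (H k.+1%:R - H k%:R) + (G k.+1%:R - G k%:R)
    - (Y 0%N k.+1%:R (tproj 1 b) - Y 0%N k%:R (tproj 1 b)).
  by rewrite /F opprD addrACA subrACA addrAC.
(* For [Plus], [P] runs from the datum to the datum plus the increment of [X], leaving [Y] at
   [k + 1]; for [Minus], it runs from the datum minus that increment to the datum, leaving [Y] at
   [k]. *)
move=> <-; rewrite /P /knot; case: eps.
  by rewrite subrr add0r [X in _ = X - _ - _]linearD [RHS]subrACA addrK subrr subr0.
rewrite subrr add0r [X in _ = _ - X - _]linearD [RHS]subrACA addrK subrr sub0r.
by rewrite -linearN opprB.
Qed.

End sawtooth_theory.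

(** * Alternating telescoping and the summation formula *)

Lemma alternating_telescope (R : pzRingType) (U : lmodType R) (D g : nat -> U) m :
  (forall j, (0 < j < m)%N -> D j = g j + g j.+1) -> (0 < m)%N ->
  g 1%N = \sum_(1 <= j < m) (-1) ^+ j.+1 *: D j + (-1) ^+ m.+1 *: g m.
Proof.
elim: m => // -[_ _ _|m ih gD _].
  by rewrite big_geq// add0r expr2 mulrNN mulr1 scale1r.
rewrite (ih _ isT) => [|j /andP[j0 jm]]; last by apply: gD; rewrite j0 ltnW.
rewrite [in RHS]big_nat_recr//= -addrA; congr (_ + _).
rewrite (gD m.+1) ?leqnn// scalerDr [in X in _ = _ + X]exprS mulN1r scaleNr.
by rewrite addrK.
Qed.

Theorem theorem3p4 (R : realType) (V W : completeNormedModType R)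
    (T : tensor_powers V) (N m : nat) (X : R -> V)
    (Y : forall l : nat, R -> {L(tpow T l.+1, W)})
    (b : truncated_tensors T m) (eps : pm) :
  (1 <= N)%N -> (1 <= m)%N ->
  rectifiable 0 N%:R X ->
  controlled_integrand N m X Y ->
  unital_tensors b ->
  let Z := sawtooth N X b eps in
  [/\ rs_integrable (@clapp R V W) (Y 0%N) X 0 N%:R,
      forall (l : nat) (t : R), (1 <= l <= m)%N -> 0 <= t <= N%:R ->
        rs_integrable (fun z v => tcons v z) (Z l) X 0 t,
      rs_integrable (@clapp R (tpow T m.+1) W) (Y m) (Z m.+1) 0 N%:R &
      riemann_sum N eps (Y 0%N) X
      = rs_integral (@clapp R V W) (Y 0%N) X 0 N%:R
        - increment N (fun t => Y 0%N t (tproj 1 b))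
        + \sum_(1 <= j < m)
            (-1) ^+ j.+1 *: increment N (fun t => Y j t (Z j.+1 t))
        + (-1) ^+ m.+1 *:
            rs_integral (@clapp R (tpow T m.+1) W) (Y m) (Z m.+1) 0 N%:R].
Proof.
move=> _ m0 X_rect Y_ctrl _ Z; have N0 := ler0n R N.
have Y0 : rectifiable 0 N%:R (Y 0%N) by apply: Y_ctrl.1.
have [H HP] := exists_primitive N0 (@clapp_short _ _ W)
  (bounded_var_rectifiable Y0) (bounded_var_rectifiable X_rect)
  (or_introl (rectifiable_unif_cont Y0)).
(* [G j] is a primitive of [Y j] against [Z j.+1], with the default 0 for [j > m]. *)
have /choice[G GP] : forall j, exists G, (j <= m)%N ->
    is_primitive (@clapp R _ W) 0 N%:R (Y j) (Z j.+1) G.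
  move=> j; case: leqP => [jm|_]; last by exists (fun=> 0).
  by have [G GP] := sawtooth_integral_exists b eps X_rect Y_ctrl jm; exists G.
have HI := primitive_rs_integral HP (lexx 0) N0 (lexx N%:R).
have GI := primitive_rs_integral (GP m (leqnn m)) (lexx 0) N0 (lexx N%:R).
split.
- by exists (H N%:R - H 0).
- move=> [//|l] t _ /andP[t0 tN]; exists (Z l.+2 t - Z l.+2 0).
  have [_ ZP] := sawtooth_primitive_bounded_var b eps X_rect l.
  exact: (primitive_rs_integral ZP).
- by exists (G m N%:R - G m 0).
rewrite (rs_integralE N0 HI) (rs_integralE N0 GI).
rewrite (riemann_sum_sawtooth X_rect Y_ctrl m0 HP (GP 1%N m0)) -[RHS]addrA.
congr (_ + _).
(* What remains expresses the integral of [Y 1] against [Z 2] by boundary terms and the remainder.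
   The index [j] stands for [l - 1], so the sign [(-1) ^+ j.+1] is that of level [l]. *)
apply: (alternating_telescope
  (D := fun j => increment N (fun t => Y j t (Z j.+1 t)))
  (g := fun j => increment N (G j)) _ m0).
move=> [//|j] /andP[_ jm].
by apply: (sawtooth_integral_step X_rect Y_ctrl jm); apply: GP; rewrite // ltnW.
Qed.
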